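(* Let $d\ge 1$ be an integer. For any pair of sequences of positive integers $b=b(n)\to\infty$ and $k=k(n)\to\infty$ (as $n\to\infty$) satisfying $n/(bk\log(b)+k\log(k))\to\infty$, there exists an estimator (a sequence of estimators) $V_n\in\mathcal{H}_{d,b}^k$ such that, for all $\varepsilon>0$, $$\sup_{p\in\mathcal{D}_d}P\left(\|V_n-p\|>3\min_{q\in\mathcal{H}_{d,b}^k}\|p-q\|+\varepsilon\right)\to 0 \quad\text{as } n\to\infty,$$ where $V_n$ is a function of $X_1,\ldots,X_n\overset{iid}{\sim}p$.
   Context: $\mathcal{D}_d$ is the set of all probability densities (with respect to Lebesgue measure) on $[0,1)^d$, and $\|\cdot\|$ is the $L^1$ norm. $[b]=\{1,\ldots,b\}$ and $\Delta_k$ is the set of probability vectors in $\mathbb{R}^k$ (nonnegative entries summing to one). For $i\in[b]$ let $h_{1,b,i}(x)=b\,\mathbf{1}\left(\frac{i-1}{b}\le x<\frac{i}{b}\right)$ on $[0,1)$, and let $\mathcal{H}_{1,b}=\operatorname{Conv}\{h_{1,b,i}: i\in[b]\}$ be the set of one-dimensional histograms with $b$ bins. The product symbol between functions denotes the outer (tensor) product: $\left(\prod_{j=1}^d f_j\right)(x_1,\ldots,x_d)=f_1(x_1)\cdots f_d(x_d)$. The set of multi-view histograms is $$\mathcal{H}_{d,b}^k=\left\{\sum_{i=1}^k w_i\prod_{j=1}^d f_{i,j}\;\middle|\; w\in\Delta_k,\ f_{i,j}\in\mathcal{H}_{1,b}\right\}.$$ An estimator $V_n\in\mathcal{H}_{d,b}^k$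 is a (measurable) map, not depending on $p$ or $\varepsilon$, from samples $(X_1,\ldots,X_n)\in([0,1)^d)^n$ to $\mathcal{H}_{d,b(n)}^{k(n)}$; $P$ is the probability over $X_1,\ldots,X_n$ iid with density $p$. *)

(* Defs.v *)
From HB Require Import structures.
From mathcomp Require Import all_boot all_order all_algebra.
From mathcomp Require Import all_classical all_reals all_analysis.
From mathcomp Require Import measurable_realfun.

Set Implicit Arguments.
Unset Strict Implicit.
Unset Printing Implicit Defensive.
Import Order.TTheory GRing.Theory Num.Theory.
Import numFieldNormedType.Exports.
Local Open Scope classical_set_scope.
Local Open Scope ring_scope.

Section cons_measure.
Context dT (T : measurableType dT) (R : realType) (n : nat).
Variables (mu : {sigma_finite_measure set T -> \bar R})
          (nu : {sigma_finite_measure set (n.-tuple T) -> \bar R}).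

Definition cons_pair (x : T * n.-tuple T) : n.+1.-tuple T :=
  [the n.+1.-tuple T of x.1 :: x.2].

Lemma measurable_cons_pair : measurable_fun setT cons_pair.
Proof. exact: measurable_cons. Qed.

Definition cons_measure : set (n.+1.-tuple T) -> \bar R :=
  pushforward (mu \x nu)%E cons_pair.

Let cons_measure0 : cons_measure set0 = 0%E.
Proof. by rewrite /cons_measure /pushforward preimage_set0 measure0. Qed.

Let measurable_preimage_cons A :
  measurable A -> measurable (cons_pair @^-1` A).
Proof.
by move=> mA; rewrite -[X in measurable X]setTI; exact: measurable_cons_pair.
Qed.

Let cons_measure_ge0 A : (0 <= cons_measure A)%E.
Proof. by rewrite /cons_measure /pushforward measure_ge0. Qed.

Let cons_measure_sigma_additive : semi_sigma_additive cons_measure.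
Proof.
move=> F mF tF mUF; rewrite /cons_measure /pushforward preimage_bigcup.
apply: measure_semi_sigma_additive.
- by move=> n'; exact: measurable_preimage_cons.
- apply/trivIsetP => /= i j _ _ ij; rewrite -preimage_setI.
  by move/trivIsetP : tF => /(_ _ _ _ _ ij) ->//; rewrite preimage_set0.
- by rewrite -preimage_bigcup; exact: measurable_preimage_cons.
Qed.

HB.instance Definition _ := isMeasure.Build _ _ _ cons_measure
  cons_measure0 cons_measure_ge0 cons_measure_sigma_additive.

Let cons_measure_sigma_finite : sigma_finite setT cons_measure.
Proof.
have /sigma_finiteP[F [TF ndF Foo]] := sigma_finiteT mu.
have /sigma_finiteP[G [TG ndG Goo]] := sigma_finiteT nu.
pose uncons (t : n.+1.-tuple T) := (thead t, [tuple of behead t]).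
have unconsK : cancel cons_pair uncons.
  by move=> [x t]; congr pair; apply/val_inj.
have muncons : measurable_fun setT uncons.
  apply/measurable_fun_pair => /=; first exact: measurable_tnth.
  exact: measurable_behead.
exists (fun i => uncons @^-1` (F i `*` G i)).
  apply/seteqP; split => // t _.
  have [i _ Fi] : (\bigcup_i F i) (thead t) by rewrite -TF.
  have [j _ Gj] : (\bigcup_i G i) [tuple of behead t] by rewrite -TG.
  exists (maxn i j) => //; split => /=.
    by move: Fi; exact/subsetPset/ndF/leq_maxl.
  by move: Gj; exact/subsetPset/ndG/leq_maxr.
move=> i; have [mF Flt] := Foo i; have [mG Glt] := Goo i; split.
  by rewrite -[X in measurable X]setTI; apply: muncons => //; exact: measurableX.
rewrite /cons_measure /pushforward -comp_preimage.
rewrite (_ : uncons \o cons_pair = id); last by apply/funext => z /=.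
by rewrite preimage_id product_measure1E// lte_mul_pinfty// ge0_fin_numE.
Qed.

HB.instance Definition _ := Measure_isSigmaFinite.Build _ _ _ cons_measure
  cons_measure_sigma_finite.

End cons_measure.

(* n-fold power of a sigma-finite measure, on the product sigma-algebra *)
Fixpoint power_measure dT (T : measurableType dT) (R : realType)
    (mu : {sigma_finite_measure set T -> \bar R}) (n : nat) :
    {sigma_finite_measure set (n.-tuple T) -> \bar R} :=
  match n with
  | 0 => \d_([tuple] : 0.-tuple T)
  | m.+1 => cons_measure mu (power_measure mu m)
  end.

Lemma power_measure_box dT (T : measurableType dT) (R : realType)
    (mu : {sigma_finite_measure set T -> \bar R}) (n : nat)
    (A : 'I_n -> set T) : (forall i, measurable (A i)) ->
  power_measure mu n [set t | forall i, A i (tnth t i)] =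
  (\prod_(i < n) mu (A i))%E.
Proof.
elim: n A => [|n IHn] A mA /=.
  by rewrite big_ord0 diracE mem_set// => -[].
rewrite big_ord_recl -IHn; last by move=> i; exact: mA.
rewrite -product_measure1E//; last first.
  rewrite (_ : [set _ | _] = \bigcap_(i in [set: 'I_n])
      ((fun t : n.-tuple T => tnth t i) @^-1` A (lift ord0 i))).
    apply: fin_bigcap_measurable => // i _; rewrite -[X in measurable X]setTI.
    exact: measurable_tnth.
  by apply/seteqP; split => [t Ht i _|t Ht i]; exact: Ht.
rewrite /cons_measure /pushforward; congr (product_measure1 _ _ _).
apply/seteqP; split => [[x t] /= H|[x t] /= [Hx Ht] i].
  split; first exact: (H ord0).
  by move=> i; have := H (lift ord0 i); rewrite tnthS.
by have [j ->|->//] := unliftP ord0 i; rewrite tnthS; exact: Ht.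
Qed.

Section multi_view_histograms.
Variable R : realType.

(* R^d and its Lebesgue measure *)
Definition Rspace (d : nat) := d.-tuple (measurableTypeR R).

Definition lebesgue (d : nat) :
    {sigma_finite_measure set (Rspace d) -> \bar R} :=
  power_measure lebesgue_measure d.

Definition unit_cube (d : nat) : set (Rspace d) :=
  [set x | forall j, 0 <= tnth x j < 1].
Arguments unit_cube : clear implicits.

(* Functions on [0,1)^d are represented by their extension by 0 to R^d. *)
Record density (d : nat) := Density {
  pdf :> Rspace d -> R ;
  measurable_pdf : measurable_fun setT pdf ;
  pdf_ge0 : forall x, 0 <= pdf x ;
  pdf_supp : forall x, ~ unit_cube d x -> pdf x = 0 ;
  integral_pdf : (\int[lebesgue d]_x (pdf x)%:E = 1)%E }.

Section density_prob.
Variables (d : nat) (p : density d).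

Definition density_prob (A : set (Rspace d)) : \bar R :=
  (\int[lebesgue d]_(x in A) (p x)%:E)%E.

Let density_prob0 : density_prob set0 = 0%E.
Proof. exact: integral_set0. Qed.

Let density_prob_ge0 A : (0 <= density_prob A)%E.
Proof. by apply: integral_ge0 => x _; rewrite lee_fin pdf_ge0. Qed.

Let density_prob_sigma_additive : semi_sigma_additive density_prob.
Proof.
move=> /= F mF tF mUF; rewrite /density_prob; apply: cvg_toP.
  apply: ereal_nondecreasing_is_cvgn => m n mn.
  by apply: lee_sum_nneg_natr => // k _ _; exact: density_prob_ge0.
rewrite ge0_integral_bigcup//=.
- by apply/measurable_EFinP/measurable_funTS; exact: measurable_pdf.
- by move=> x _; rewrite lee_fin pdf_ge0.
Qed.

HB.instance Definition _ := isMeasure.Build _ _ _ density_prob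
  density_prob0 density_prob_ge0 density_prob_sigma_additive.

Let density_probT : density_prob setT = 1%E.
Proof. exact: integral_pdf. Qed.

HB.instance Definition _ := Measure_isProbability.Build _ _ R density_prob
  density_probT.

(* the joint law of n independent random variables with density p *)
Definition iid_law (n : nat) :
    {sigma_finite_measure set (n.-tuple (Rspace d)) -> \bar R} :=
  power_measure density_prob n.

Lemma iid_lawT n : iid_law n setT = 1%E.
Proof.
have := @power_measure_box _ _ _ density_prob n (fun=> setT) (fun=> measurableT).
rewrite (_ : [set _ | _] = setT); last by apply/seteqP; split.
by move=> ->; rewrite big1// => i _; exact: density_probT.
Qed.

End density_prob.

Definition L1dist (d : nat) (f g : Rspace d -> R) : \bar R :=
  ('N[lebesgue d]_1 [EFin \o (f \- g)%R])%E.

Definition simplex (k : nat) : set ('I_k -> R) :=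
  [set w | (forall i, 0 <= w i) /\ \sum_i w i = 1].
Arguments simplex : clear implicits.

Definition bin_density (b : nat) (i : 'I_b) (x : R) : R :=
  b%:R * \1_(`[i%:R / b%:R, i.+1%:R / b%:R[%classic) x.

Definition histogram1 (b : nat) : set (R -> R) :=
  [set f | exists2 c, simplex b c &
     f = fun x => \sum_i c i * @bin_density b i x].
Arguments histogram1 : clear implicits.

Definition multi_view_histogram (d b k : nat) : set (Rspace d -> R) :=
  [set q | exists w : 'I_k -> R, exists f : 'I_k -> 'I_d -> R -> R,
     [/\ simplex k w, forall i j, histogram1 b (f i j) &
       q = fun x => \sum_i w i * \prod_j f i j (tnth x j)]].
Arguments multi_view_histogram : clear implicits.

(* This infimum is attained, see min_L1dist_attained. *)
Definition min_L1dist (d b k : nat) (p : Rspace d -> R) : \bar R :=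
  ereal_inf [set L1dist p q | q in multi_view_histogram d b k].

Definition sample_space (d n : nat) : set (n.-tuple (Rspace d)) :=
  [set s | forall i, unit_cube d (tnth s i)].
Arguments sample_space : clear implicits.

Definition L1open (d : nat) (H U : set (Rspace d -> R)) : Prop :=
  U `<=` H /\ forall f, U f -> exists2 r : R, 0 < r &
    forall g, H g -> (L1dist f g < r%:E)%E -> U g.

(* A map from samples to the histograms, Borel measurable for the L1 distance.
   Its values on tuples outside of ([0,1)^d)^n are irrelevant. *)
Definition is_estimator (d b k n : nat)
    (V : n.-tuple (Rspace d) -> Rspace d -> R) : Prop :=
  (forall s, sample_space d n s -> multi_view_histogram d b k (V s)) /\
  (forall U, L1open (multi_view_histogram d b k) U ->
     measurable (sample_space d n `&` V @^-1` U)).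

End multi_view_histograms.

Arguments unit_cube {R} d.
Arguments simplex {R} k.
Arguments histogram1 {R} b.
Arguments multi_view_histogram {R} d b k.
Arguments sample_space {R} d n.

Section min_L1dist_attained.
Variable R : realType.

Lemma measurable_unit_cube d : measurable (unit_cube d : set (Rspace R d)).
Proof.
rewrite (_ : unit_cube d = \bigcap_(j in [set: 'I_d])
    ((fun x : Rspace R d => tnth x j) @^-1` `[0, 1[)).
  apply: fin_bigcap_measurable => // j _; rewrite -[X in measurable X]setTI.
  by apply: measurable_tnth => //; exact: measurable_itv.
apply/seteqP; split => [x xP j _|x xP j] /=; first by rewrite in_itv/=; exact: xP.
by have /= := xP j I; rewrite in_itv.
Qed.

Lemma lebesgue_unit_cube d : lebesgue R d (unit_cube d) = 1%E.
Proof.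
have := @power_measure_box _ _ R lebesgue_measure d (fun=> `[0, 1[%classic)
  (fun=> measurable_itv _).
rewrite (_ : [set _ | _] = unit_cube d); last first.
  by apply/seteqP; split => x xP j; have /= := xP j; rewrite in_itv.
move=> ->; rewrite big1// => i _.
transitivity (lebesgue_measure `[0%R, 1%R[%classic : \bar R) => //.
by rewrite lebesgue_measure_itv/= lte_fin ltr01 oppr0 adde0.
Qed.

Lemma L1distE d (f g : Rspace R d -> R) :
  L1dist f g = (\int[lebesgue R d]_x `|f x - g x|%:E)%E.
Proof. by rewrite /L1dist Lnorm1. Qed.

Lemma L1dist_le d (f g h : Rspace R d -> R) (c : R) :
  measurable_fun setT f -> measurable_fun setT g -> measurable_fun setT h ->
  0 <= c -> (forall x, `|g x - h x| <= c * \1_(unit_cube d) x) ->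
  (L1dist f h <= L1dist f g + c%:E)%E.
Proof.
move=> mf mg mh c0 gh; rewrite !L1distE.
have mcube := @measurable_unit_cube d.
have mn (u : Rspace R d -> R) : measurable_fun setT u ->
    measurable_fun setT (fun x : Rspace R d => (`|f x - u x|)%:E).
  move=> mu; apply/measurable_EFinP; apply: measurableT_comp => //.
  exact: measurable_funB.
have mc : measurable_fun setT
    (fun x : Rspace R d => (c * \1_(unit_cube d) x)%:E).
  by apply/measurable_EFinP; apply: measurable_funM => //; exact: measurable_indic.
apply: (@le_trans _ _ (\int[lebesgue R d]_x
    (`|f x - g x|%:E + (c * \1_(unit_cube d) x)%:E))%E).
  apply: ge0_le_integral => //.
  - exact: mn.
  - by apply: emeasurable_funD => //; exact: mn.
  - move=> x _; rewrite -EFinD lee_fin.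
    rewrite (_ : f x - h x = (f x - g x) + (g x - h x)); last by rewrite addrA subrK.
    by rewrite (le_trans (ler_normD _ _))// lerD2l.
rewrite ge0_integralD//.
- rewrite leeD2l//.
  under eq_integral do rewrite EFinM.
  rewrite ge0_integralZl//; last first.
    by apply/measurable_EFinP; exact: measurable_indic.
  by rewrite integral_indic// setIT [X in (_ * X)%E](lebesgue_unit_cube d) mule1.
- exact: mn.
- by move=> x _; rewrite lee_fin mulr_ge0.
Qed.

Let continuous_modulus (T : topologicalType) (g : T -> T -> R) (f : T -> R) :
  (forall v, continuous (g v)) -> (forall v, g v v = 0) ->
  (forall v v', `|f v - f v'| <= g v v') -> continuous f.
Proof.
move=> cg gvv fg v; apply/cvgrPdist_lt => e e0.
have := cg v v; rewrite /continuous_at gvv => /cvgrPdist_lt/(_ _ e0); apply: filterS => v'.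
by rewrite sub0r normrN; apply: le_lt_trans; exact: le_trans (ler_norm _).
Qed.

Section attained.
Variables d b k : nat.
Let I : choiceType := ('I_k + 'I_k * 'I_d * 'I_b)%type.
Let X := prod_topology (fun _ : I => R : topologicalType).

Let hist (v : X) (x : Rspace R d) : R :=
  \sum_i v (inl i) * \prod_j \sum_l v (inr (i, j, l)) * bin_density l (tnth x j).

Let coef (v : X) (i : 'I_k) (m : {ffun 'I_d -> 'I_b}) : R :=
  v (inl i) * \prod_j v (inr (i, j, m j)).

Let atom (m : {ffun 'I_d -> 'I_b}) (x : Rspace R d) : R :=
  \prod_j bin_density (m j) (tnth x j).

Let histE v x : hist v x = \sum_i \sum_m coef v i m * atom m x.
Proof.
apply: eq_bigr => i _; rewrite bigA_distr_bigA mulr_sumr.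
by apply: eq_bigr => m _; rewrite big_split/= mulrA.
Qed.

Let bin_density_bound (l : 'I_b) (x : R) :
  0 <= bin_density l x <= b%:R * \1_(`[0, 1[%classic) x.
Proof.
rewrite /bin_density mulr_ge0//= ler_wpM2l//.
have b0 : 0 < b%:R :> R by rewrite ltr0n (leq_trans _ (ltn_ord l)).
rewrite !indicE; case: (boolP (x \in _)) => // /set_mem /=.
rewrite in_itv/= => /andP[lx xl]; rewrite mem_set//= in_itv/=.
rewrite (le_trans _ lx) ?divr_ge0//= (lt_le_trans xl)// ler_pdivrMr// mul1r.
by rewrite ler_nat ltn_ord.
Qed.

Let atom_bound m x : `|atom m x| <= b%:R ^+ d * \1_(unit_cube d) x.
Proof.
rewrite ger0_norm; last first.
  by apply: prodr_ge0 => j _; have /andP[] := bin_density_bound (m j) (tnth x j).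
apply: (@le_trans _ _ (\prod_(j < d) (b%:R * \1_(`[0, 1[%classic) (tnth x j)))).
  by apply: ler_prod => j _; exact: bin_density_bound.
rewrite big_split/= prodr_const card_ord ler_wpM2l ?exprn_ge0//.
rewrite [leRHS]indicE; case: (boolP (x \in _)) => /=.
  by move=> _; apply: prodr_ile1 => j _; rewrite indicE ler0n lern1 leq_b1.
rewrite notin_setE => /existsNP[j xj].
rewrite (bigD1 j)//= indicE memNset ?mul0r//=.
Qed.

Let measurable_hist v : measurable_fun setT (hist v).
Proof.
apply: measurable_sum => i; apply: measurable_funM => //.
apply: measurable_prod => j _; apply: measurable_sum => l.
apply: measurable_funM => //; apply: measurable_funM => //.
apply: (@measurableT_comp _ _ _ _ _ _ 
  (\1_(`[l%:R / b%:R, l.+1%:R / b%:R[%classic) : measurableTypeR R -> R) _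
  (fun x : Rspace R d => tnth x j)).
  by apply: measurable_indic; exact: measurable_itv.
exact: measurable_tnth.
Qed.

Let gap (v v' : X) : R :=
  (\sum_i \sum_m `|coef v i m - coef v' i m|) * b%:R ^+ d.

Let gap_ge0 v v' : 0 <= gap v v'.
Proof.
by rewrite mulr_ge0 ?exprn_ge0// sumr_ge0// => i _; rewrite sumr_ge0.
Qed.

Let gapC v v' : gap v v' = gap v' v.
Proof.
by congr (_ * _); apply: eq_bigr => i _; apply: eq_bigr => m _; rewrite distrC.
Qed.

Let hist_gap v v' x : `|hist v x - hist v' x| <= gap v v' * \1_(unit_cube d) x.
Proof.
rewrite !histE -sumrB /gap -mulrA mulr_suml (le_trans (ler_norm_sum _ _ _))//.
apply: ler_sum => i _; rewrite -sumrB mulr_suml (le_trans (ler_norm_sum _ _ _))//.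
by apply: ler_sum => m _; rewrite -mulrBl normrM ler_wpM2l ?atom_bound.
Qed.

Let continuous_eval z : continuous (fun v : X => v z).
Proof. exact: (@proj_continuous I (fun=> R : topologicalType) z). Qed.

Let continuous_sum (J : Type) (s : seq J) (F : J -> X -> R) :
  (forall j, continuous (F j)) -> continuous (fun v => \sum_(j <- s) F j v).
Proof. by move=> cF; apply: continuous_big => //; exact: add_continuous. Qed.

Let continuous_prod (J : Type) (s : seq J) (F : J -> X -> R) :
  (forall j, continuous (F j)) -> continuous (fun v => \prod_(j <- s) F j v).
Proof. by move=> cF; apply: continuous_big => //; exact: mul_continuous. Qed.

Let continuous_mul (f g : X -> R) :
  continuous f -> continuous g -> continuous (fun v => f v * g v).
Proof. by move=> cf cg v; exact: (cvgM (cf v) (cg v)). Qed.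

Let continuous_mulr (c : R) (f : X -> R) :
  continuous f -> continuous (fun v => f v * c).
Proof. by move=> cf v; exact: (cvgM (cf v) (cvg_cst c)). Qed.

Let continuous_coef i m : continuous (fun v => coef v i m).
Proof.
have cp : continuous (fun v : X => \prod_j v (inr (i, j, m j))).
  by apply: continuous_prod => j; exact: continuous_eval.
exact: (continuous_mul (@continuous_eval (inl i)) cp).
Qed.

Let continuous_gap v : continuous (gap v).
Proof.
have cg : continuous (fun v' => \sum_i \sum_m `|coef v i m - coef v' i m|).
  apply: continuous_sum => i; apply: continuous_sum => m v'.
  exact: (cvg_norm (cvgB (cvg_cst (coef v i m)) (@continuous_coef i m v'))).
exact: (@continuous_mulr (b%:R ^+ d) _ cg).
Qed.

Let gapvv v : gap v v = 0.
Proof.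
rewrite /gap big1 ?mul0r// => i _; rewrite big1// => m _.
by rewrite subrr normr0.
Qed.

Let params : set X :=
  [set v : X | forall z, `[0, 1]%classic (v z)] `&`
  ([set v : X | \sum_i v (inl i) = 1] `&`
   \bigcap_(ij in [set: 'I_k * 'I_d])
     [set v : X | \sum_l v (inr (ij.1, ij.2, l)) = 1]).

Let compact_params : compact params.
Proof.
apply: compact_closedI.
  apply: (@tychonoff I (fun=> R : topologicalType) (fun=> `[0, 1]%classic)).
  by move=> _; exact: segment_compact.
apply: closedI.
  rewrite (_ : [set v | _] = (fun v : X => \sum_i v (inl i)) @^-1` [set x | x = 1])//.
  apply: (continuous_closedP _).1; last exact: closed_eq.
  by apply: continuous_sum => i; exact: continuous_eval.
apply: closed_bigI => -[i j] _.
rewrite (_ : [set v | _] =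
  (fun v : X => \sum_l v (inr (i, j, l))) @^-1` [set x | x = 1])//.
apply: (continuous_closedP _).1; last exact: closed_eq.
by apply: continuous_sum => l; exact: continuous_eval.
Qed.

Let simplex_le1 n (w : 'I_n -> R) i : simplex n w -> w i \in `[0, 1].
Proof.
move=> [w0 w1]; rewrite in_itv/= w0/= -w1 (bigD1 i)//= lerDl.
exact: sumr_ge0.
Qed.

Let histP q : multi_view_histogram d b k q <->
  exists2 v : X, params v & q = hist v.
Proof.
split=> [[w [f [sw hf ->]]]|[v [v01 [v1 v2]] ->]].
  pose c i j := sval (cid2 (hf i j)).
  have sc i j : simplex b (c i j) by rewrite /c; case: cid2.
  have fE i j : f i j = fun x => \sum_l c i j l * bin_density l x.
    by rewrite /c; case: cid2.
  exists ((fun z => match z with inl i => w i | inr (i, j, l) => c i j l end) : X).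
    split=> [[i|[[i j] l]]|]; try exact: simplex_le1.
    by split; [have [] := sw|move=> [i j] _; have [] := sc i j].
  apply/funext => x; apply: eq_bigr => i _; congr (_ * _).
  by apply: eq_bigr => j _; rewrite fE.
have v0 z : 0 <= v z by have := v01 z; rewrite /= in_itv/= => /andP[].
exists (fun i => v (inl i)).
exists (fun i j x => \sum_l v (inr (i, j, l)) * bin_density l x).
split => // i j; exists (fun l => v (inr (i, j, l))) => //.
by split => //; exact: (v2 (i, j)).
Qed.

Lemma min_L1dist_attained (p : density R d) : (0 < b)%N -> (0 < k)%N ->
  exists2 q, multi_view_histogram d b k q & min_L1dist b k p = L1dist p q.
Proof.
move=> b0 k0.
pose zero : X := fun=> 0.
have hist0 : hist zero = fun=> 0.
  by apply/funext => x; rewrite /hist big1// => i _; rewrite mul0r.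
have dist0 : L1dist p (hist zero) = 1%E.
  rewrite hist0 L1distE -(integral_pdf p); apply: eq_integral => x _.
  by rewrite subr0 ger0_norm// pdf_ge0.
have dist_gap v v' : (L1dist p (hist v') <= L1dist p (hist v) + (gap v v')%:E)%E.
  by apply: L1dist_le => //; exact: measurable_pdf.
have dist_fin v : L1dist p (hist v) \is a fin_num.
  rewrite ge0_fin_numE; last by rewrite L1distE; exact: integral_ge0.
  by rewrite (le_lt_trans (dist_gap zero v))// dist0 -EFinD ltry.
pose F v := fine (L1dist p (hist v)).
have FE v : (F v)%:E = L1dist p (hist v) by rewrite /F fineK.
have F_gap v v' : F v' <= F v + gap v v' by rewrite -lee_fin EFinD !FE.
have cF : continuous F.
  apply: (continuous_modulus continuous_gap gapvv) => v v'.
  by rewrite ler_distl lerBlDr F_gap gapC F_gap.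
have params0 : params !=set0.
  pose l0 := Ordinal b0; pose i0 := Ordinal k0.
  exists ((fun z => match z with
    | inl i => (i == i0)%:R | inr (i, j, l) => (l == l0)%:R end) : X).
  split=> [[i|[[i j] l]]|]; rewrite /= ?in_itv/= ?ler0n ?lern1 ?leq_b1//.
  split=> [|[i j] _] /=.
    by rewrite (bigD1 i0)//= big1 ?addr0 ?eqxx// => i /negbTE ->.
  by rewrite (bigD1 l0)//= big1 ?addr0 ?eqxx// => l /negbTE ->.
have [|v] := compact_EVT_min params0 compact_params (f := F).
  exact: continuous_subspaceT.
rewrite inE => vP vmin; exists (hist v); first by apply/histP; exists v.
apply/eqP; rewrite eq_le; apply/andP; split.
  by apply: ereal_inf_lbound; exists (hist v) => //; apply/histP; exists v.
apply: le_ereal_inf_tmp => _ [q /histP[v' v'P ->] <-].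
by rewrite -!FE lee_fin; apply: vmin; rewrite inE.
Qed.
End attained.
End min_L1dist_attained.

(* Main.v *)
(* A multi-view histogram is determined by k weights and k d vectors of b bin
   weights.  Rounding them to proportions of integers below k^2 + 2,
   respectively b^2 + 2, moves the histogram by O(1/k + d/b) in L1 and leaves
   at most exp (3 d (b k ln b + k ln k)) candidates; as b and k tend to
   infinity, no further accuracy parameter is needed, hence none depends on
   epsilon.  The estimator is the minimum distance (Yatracos, Devroye-Lugosi)
   selection among these candidates g_z: it minimizes the largest gap between
   the mass given by g_z and the empirical measure on the sets {g_x > g_y}.  Up
   to 4 times the largest deviation of the empirical measure on these sets, its
   error is at most 3 times that of the best candidate.  A Chernoff bound and a
   union bound over the pairs of candidates control the deviation. *)
Require Import Defs.
From mathcomp Require Import all_boot all_order all_algebra.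
From mathcomp Require Import all_classical all_reals all_analysis.
From mathcomp Require Import measurable_realfun ring lra.
Set Implicit Arguments.
Unset Strict Implicit.
Unset Printing Implicit Defensive.
Import Order.TTheory GRing.Theory Num.Theory.
Import numFieldNormedType.Exports.
Local Open Scope classical_set_scope.
Local Open Scope ring_scope.

(** * Concentration of empirical frequencies *)

(** Independence of the coordinates, by induction on [n]: [power_measure] is the image of a product
    measure under [cons_pair], so Tonelli splits off the first factor. It serves twice: for moment
    generating functions of samples and for the total mass of an [atom]. *)
Lemma integral_power_measure_prod (dT : measure_display)
    (T : measurableType dT) (R : realType)
    (mu : {sigma_finite_measure set T -> \bar R}) (n : nat)
    (f : 'I_n -> T -> R) :
  (forall i, measurable_fun setT (f i)) -> (forall i x, 0 <= f i x) ->
  (\int[power_measure mu n]_t (\prod_(i < n) f i (tnth t i))%:E =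
   \prod_(i < n) \int[mu]_x (f i x)%:E)%E.
Proof.
elim: n f => [|n IHn] f mf f0.
  rewrite big_ord0 integral_dirac//=; last first.
    by apply/measurable_EFinP; apply: measurable_prod => -[].
  by rewrite diracT big_ord0 mule1.
have mprod m (g : 'I_m -> T -> R) : (forall i, measurable_fun setT (g i)) ->
    measurable_fun setT
      (fun t : m.-tuple T => (\prod_(i < m) g i (tnth t i))%:E).
  move=> mg; apply/measurable_EFinP; apply: measurable_prod => i _.
  exact: (measurableT_comp (mg i) (measurable_tnth i)).
have prod0 m (g : 'I_m -> T -> R) (t : m.-tuple T) :
    (forall i x, 0 <= g i x) -> (0 <= (\prod_(i < m) g i (tnth t i))%:E)%E.
  by move=> g0; rewrite lee_fin prodr_ge0.
transitivity (\int[mu \x power_measure mu n]_z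
    (f ord0 z.1 * \prod_(i < n) f (lift ord0 i) (tnth z.2 i))%:E)%E.
  rewrite /= /cons_measure.
  rewrite ge0_integral_pushforward//=; last 3 first.
  - exact: measurable_cons_pair.
  - exact: mprod.
  - by move=> t _; exact: prod0.
  apply: eq_integral => -[x t] _ /=; congr EFin; rewrite big_ord_recl.
  by congr (_ * _); apply: eq_bigr => i _; rewrite tnthS.
rewrite fubini_tonelli1; last 2 first.
- apply/measurable_EFinP; apply: measurable_funM.
    exact: (measurableT_comp (mf ord0) measurable_fst).
  apply: measurable_prod => i _.
  have mtnth : measurable_fun setT (fun z : T * n.-tuple T => tnth z.2 i).
    exact: (measurableT_comp (measurable_tnth i) measurable_snd).
  exact: (measurableT_comp (mf (lift ord0 i)) mtnth).
- by move=> z; rewrite lee_fin mulr_ge0// prodr_ge0.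
rewrite big_ord_recl -IHn// /fubini_F.
rewrite -ge0_integralZr//=.
- apply: eq_integral => x _; under eq_integral do rewrite EFinM.
  rewrite ge0_integralZl// ?lee_fin//.
    exact: (mprod n (fun i => f (lift ord0 i))).
  by move=> t _; exact: (prod0 n (fun i => f (lift ord0 i))).
- exact/measurable_EFinP.
- by move=> x _; rewrite lee_fin.
- by apply: integral_ge0 => t _; exact: (prod0 n (fun i => f (lift ord0 i))).
Qed.

(** From [1 - x <= expR (- x)] one gets [(1 - x) * expR x <= 1], while [(1 - x) * (1 + x + 2 * x ^+
    2) = 1 + x ^+ 2 * (1 - 2 * x)] is at least 1 for [x <= 1/2]. *)
Lemma expR_le_quadratic (R : realType) (x : R) :
  x <= 2^-1 -> expR x <= 1 + x + 2 * x ^+ 2.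
Proof.
move=> x2; have x1 : 0 < 1 - x by lra.
rewrite -(ler_pM2l x1) (@le_trans _ _ 1)//; last by nra.
rewrite -[leRHS](expRxMexpNx_1 x) mulrC ler_wpM2l ?expR_ge0//.
exact: expR_ge1Dx.
Qed.

(** A centered Bernoulli variable takes the values [1 - p] and [- p]. Applying [expR_le_quadratic]
    to both exponents and averaging, the linear terms cancel; what remains is at most
    [1 + 2 * l ^+ 2]. *)
Lemma probability_mgf_le (dT : measure_display) (T : measurableType dT)
    (R : realType) (P : probability T R) (A : set T) (l : R) :
  measurable A -> 0 <= l <= 2^-1 ->
  (\int[P]_x (expR (l * (\1_A x - fine (P A))))%:E <=
   (expR (2 * l ^+ 2))%:E)%E.
Proof.
move=> mA /andP[l0 l2]; set p := fine (P A).
have PA : P A = p%:E by rewrite fineK// fin_num_measure.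
have /andP[p0 p1] : 0 <= p <= 1.
  by rewrite -!lee_fin -PA measure_ge0 probability_le1.
have mE (c : R) (B : set T) : measurable B ->
    measurable_fun setT (fun x => c%:E * (\1_B x)%:E)%E.
  move=> mB; apply/measurable_EFinP.
  by apply: measurable_funM => //; exact: measurable_indic.
have E0 (c : R) (B : set T) x : 0 <= c -> (0 <= c%:E * (\1_B x)%:E :> \bar R)%E.
  by move=> c0; rewrite -EFinM lee_fin mulr_ge0.
have -> : (\int[P]_x (expR (l * (\1_A x - p)))%:E =
    \int[P]_x ((expR (l * (1 - p)))%:E * (\1_A x)%:E +
                (expR (- l * p))%:E * (\1_(~` A) x)%:E))%E.
  apply: eq_integral => x _; rewrite -!EFinM -EFinD !indicE in_setC.
  by case: (x \in A) => /=; rewrite ?mulr1 ?mulr0 ?addr0 ?add0r// mulrN mulNr.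
rewrite ge0_integralD//; last first.
all: try by [apply: mE => //; exact: measurableC].
all: try by [move=> x _; apply: E0; exact: expR_ge0].
have mI (B : set T) : measurable B ->
    measurable_fun setT (fun x => (\1_B x : R)%:E).
  by move=> mB; apply/measurable_EFinP; exact: measurable_indic.
rewrite !ge0_integralZl ?lee_fin ?expR_ge0//; [|exact/mI/measurableC|exact: mI].
rewrite !integral_indic//; last exact: measurableC.
have PC : P (~` A) = (1 - p)%:E by rewrite probability_setC// PA.
rewrite !setIT [X in (_ * X + _)%E]PA [X in (_ + _ * X)%E]PC.
rewrite -!EFinM -EFinD lee_fin.
apply: (@le_trans _ _ (1 + 2 * l ^+ 2)); last exact: expR_ge1Dx.
have h1 : expR (l * (1 - p)) <= 1 + l * (1 - p) + 2 * l ^+ 2.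
  apply: le_trans (expR_le_quadratic _) _; first by nra.
  by rewrite lerD2l ler_wpM2l// exprMn ler_piMr ?sqr_ge0// expr_le1//; lra.
have h2 : expR (- l * p) <= 1 - l * p + 2 * l ^+ 2.
  apply: le_trans (expR_le_quadratic _) _; first by nra.
  rewrite mulNr lerD2l ler_wpM2l// sqrrN exprMn ler_piMr ?sqr_ge0//.
  by rewrite expr_le1//; lra.
nra.
Qed.

Lemma measurable_ge_set (dT : measure_display) (T : measurableType dT)
    (R : realType) (f : T -> R) (t : R) :
  measurable_fun setT f -> measurable [set x | t <= f x].
Proof.
move=> mf; rewrite (_ : [set x | _] = setT `&` f @^-1` `[t, +oo[).
  exact: mf.
by apply/seteqP; split => x /=; rewrite in_itv/= andbT; [|case].
Qed.

Definition empirical {T : Type} {R : realType} {n : nat} (A : set T)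
    (s : n.-tuple T) : R :=
  (\sum_(i < n) \1_A (tnth s i)) / n%:R.

Lemma measurable_empirical (dT : measure_display) (T : measurableType dT)
    (R : realType) (n : nat) (A : set T) : measurable A ->
  measurable_fun setT (empirical A : n.-tuple T -> R).
Proof.
move=> mA; apply: measurable_funM => //; apply: measurable_sum => i.
exact: (measurableT_comp (measurable_indic mA) (measurable_tnth i)).
Qed.

Section concentration.
Context (dT : measure_display) (T : measurableType dT) (R : realType).
Variables (P : probability T R) (n : nat).
Hypothesis n_gt0 : (0 < n)%N.

(** Chernoff's method: Markov's inequality for the exponential of the centered sum ([lower]), whose
    integral factorizes over the sample ([upper]). *)
Lemma empirical_upper_tail (A : set T) (t : R) :
  measurable A -> 0 <= t <= 2 ->
  (power_measure P n [set s | (t <= empirical A s - fine (P A))%R]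
     <= (expR (- (n%:R * t ^+ 2 / 8)))%:E)%E.
Proof.
move=> mA /andP[t0 t2]; set E := [set s | _]; set p := fine (P A).
(* This [l] minimizes the exponent [- l * n * t + 2 * n * l ^+ 2], with value [- n * t ^+ 2 / 8];
   the condition [t <= 2] becomes [l <= 1/2]. *)
pose l := t / 4; pose mu := power_measure P n.
have n0 : 0 < n%:R :> R by rewrite ltr0n.
have l0 : 0 <= l by rewrite /l; lra.
pose f (x : T) : R := expR (l * (\1_A x - p)).
have mf : measurable_fun setT f.
  apply: measurableT_comp => //; apply: measurable_funM => //.
  by apply: measurable_funB => //; exact: measurable_indic.
have mE : measurable E.
  apply: measurable_ge_set; apply: measurable_funB => //.
  exact: measurable_empirical.
have mprod : measurable_fun setT
    (fun s : n.-tuple T => (\prod_(i < n) f (tnth s i))%:E).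
  apply/measurable_EFinP; apply: measurable_prod => i _.
  exact: (measurableT_comp mf (measurable_tnth i)).
have prod0 (s : n.-tuple T) : (0 <= (\prod_(i < n) f (tnth s i))%:E)%E.
  by rewrite lee_fin prodr_ge0// => i _; exact: expR_ge0.
have lower : ((expR (l * (n%:R * t)))%:E * mu E <=
    \int[mu]_s (\prod_(i < n) f (tnth s i))%:E)%E.
  rewrite -(integral_cst mu mE).
  apply: (@le_trans _ _ (\int[mu]_(s in E) (\prod_(i < n) f (tnth s i))%:E)%E).
    apply: ge0_le_integral => //=.
    - exact: measurable_funTS.
    - move=> s Es; rewrite lee_fin -expR_sum ler_expR -mulr_sumr ler_wpM2l//.
      move: Es; rewrite /E/= lerBrDr /empirical ler_pdivlMr// sumrB sumr_const.
      rewrite card_ord -mulr_natr -/p => Es; lra.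
  by apply: ge0_subset_integral => //.
have upper : (\int[mu]_s (\prod_(i < n) f (tnth s i))%:E <=
    (expR (n%:R * (2 * l ^+ 2)))%:E)%E.
  rewrite (@integral_power_measure_prod _ _ _ _ _ (fun=> f))//; last first.
    by move=> _ x; exact: expR_ge0.
  rewrite expRM_natl -[X in expR _ ^+ X]card_ord -prodr_const -prodEFin.
  (* Multiplying inequalities in [\bar R] requires nonnegative factors, so the induction over the
     product carries both facts. *)
  pose le0 (x y : \bar R) := (0 <= x)%E /\ (x <= y)%E.
  suff [] : le0 (\prod_(i < n) \int[P]_x (f x)%:E)%E
                (\prod_(i < n) (expR (2 * l ^+ 2))%:E)%E by [].
  apply: (big_ind2 le0) => [|x1 x2 y1 y2 [x0 x12] [y0 y12]|i _]; split => //.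
  - exact: mule_ge0.
  - exact: lee_pmul.
  - by apply: integral_ge0 => z _; rewrite lee_fin expR_ge0.
  - by apply: probability_mgf_le => //; rewrite l0/= /l; lra.
have := le_trans lower upper; rewrite -lee_pdivlMl ?expR_gt0//.
move=> /le_trans; apply.
rewrite -expRN -EFinM -expRD lee_fin ler_expR /l le_eqVlt; apply/orP; left.
by apply/eqP; field.
Qed.

Lemma empirical_lower_tail (A : set T) (t : R) :
  measurable A -> 0 <= t <= 2 ->
  (power_measure P n [set s | (t <= fine (P A) - empirical A s)%R]
     <= (expR (- (n%:R * t ^+ 2 / 8)))%:E)%E.
Proof.
move=> mA t02; have := empirical_upper_tail (measurableC mA) t02.
have n0 : n%:R != 0 :> R by rewrite pnatr_eq0 -lt0n.
rewrite probability_setC// fineB ?fin_num_measure//=.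
have empC (s : n.-tuple T) : empirical (~` A) s = 1 - empirical A s :> R.
  rewrite /empirical (_ : \sum_(i < n) _ = n%:R - \sum_(i < n) \1_A (tnth s i)).
    by rewrite mulrBl mulfV.
  rewrite -[X in X%:R - _]card_ord -sumr_const -sumrB.
  apply: eq_bigr => i _; rewrite !indicE in_setC.
  by case: (_ \in _); rewrite ?subrr ?subr0.
congr (power_measure P n _ <= _)%E.
by apply/seteqP; split => s /=; rewrite empC; lra.
Qed.

(** Union bound over the index and over the sign of the deviation. *)
Lemma empirical_uniform_deviation (I : finType) (A : I -> set T) (t : R) :
  (forall i, measurable (A i)) -> 0 <= t <= 2 ->
  (power_measure P n
     [set s | exists i, (t <= `|empirical (A i) s - fine (P (A i))|)%R]
   <= (2 * #|I|%:R * expR (- (n%:R * t ^+ 2 / 8)))%:E)%E.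
Proof.
move=> mA t02; set u := expR _; pose mu := power_measure P n.
pose B i := [set s : n.-tuple T | t <= empirical (A i) s - fine (P (A i))].
pose C i := [set s : n.-tuple T | t <= fine (P (A i)) - empirical (A i) s].
have mB i : measurable (B i).
  apply: measurable_ge_set; apply: measurable_funB => //.
  exact: measurable_empirical.
have mC i : measurable (C i).
  apply: measurable_ge_set; apply: measurable_funB => //.
  exact: measurable_empirical.
have -> : [set s | exists i, t <= `|empirical (A i) s - fine (P (A i))|] =
    \bigcup_(i in [set: I]) (B i `|` C i).
  apply/seteqP; split=> [s [i]|s [i _ BCi]].
    by rewrite ler_normr opprB => /orP[]; exists i => //; [left|right].
  by exists i; rewrite ler_normr opprB; apply/orP; case: BCi; [left|right].
apply: (@le_trans _ _ (\sum_(i \in [set: I]) mu (B i `|` C i))%E).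
  apply: content_sub_fsum; [exact: finite_finset| | |by []].
  - by move=> i _; exact: measurableU.
  - apply: fin_bigcup_measurable => [|i _]; first exact: finite_finset.
    exact: measurableU.
rewrite (@fsbigE _ _ _ _ _ (index_enum I)) ?index_enum_uniq//=; last first.
  by move=> i _; rewrite mem_index_enum.
apply: (@le_trans _ _ (\sum_(i : I) (2 * u)%:E)%E).
  rewrite big_mkcond; apply: lee_sum => i _; rewrite in_setT.
  apply: le_trans (measureU2 _ (mB i) (mC i)) _; rewrite mulr_natl mulr2n EFinD.
  by apply: leeD; [exact: empirical_upper_tail|exact: empirical_lower_tail].
by rewrite sumEFin sumr_const -(mulr_natr (2 * u)) mulrAC.
Qed.

End concentration.

(** * Measurability of events determined by empirical frequencies *)

Section finite_data.
Context (dT : measure_display) (T : measurableType dT) (R : realType).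
Variables (n : nat) (I : finType) (A : I -> set T).
Hypothesis mA : forall i, measurable (A i).

(* No regularity of [Y] is needed, because the vector of empirical frequencies
   takes finitely many values. *)
Lemma measurable_empirical_event (Y : set (I -> R)) :
  measurable [set s : n.-tuple T | Y (fun i => empirical (A i) s)].
Proof.
(* The table of memberships determines all frequencies. The event is thus a finite union, over the
   admissible tables, of the measurable sets of samples with a given table. *)
pose data (s : n.-tuple T) := [ffun z : 'I_n * I => tnth s z.1 \in A z.2].
pose emp (y : {ffun 'I_n * I -> bool}) (i : I) : R :=
  (\sum_(j < n) (y (j, i))%:R) / n%:R.
have empE s : (fun i => empirical (A i) s) = emp (data s).
  apply/funext => i; congr (_ / _); apply: eq_bigr => j _.
  by rewrite ffunE indicE.
rewrite (_ : [set s | _] = \bigcup_(y in [set y | Y (emp y)])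
    \bigcap_(z in [set: 'I_n * I])
      ((fun s : n.-tuple T => tnth s z.1) @^-1`
        (if y z then A z.2 else ~` A z.2))).
  apply: fin_bigcup_measurable => [|y _]; first exact: finite_finset.
  apply: fin_bigcap_measurable => [|z _]; first exact: finite_finset.
  rewrite -[X in measurable X]setTI; apply: measurable_tnth => //.
  by case: (y z) => //; exact: measurableC.
apply/seteqP; split => [s|s [y Yy ys]] /=; rewrite empE.
  move=> Ys; exists (data s) => // z _ /=; rewrite ffunE.
  by case: ifPn => [/set_mem|/negP h] // As; apply: h; exact: mem_set.
rewrite (_ : data s = y)//; apply/ffunP => z; rewrite ffunE.
have /= := ys z Logic.I; case: (y z) => [/mem_set ->//|nA].
by apply/negbTE/negP => /set_mem.
Qed.

End finite_data.

(** * Minimum distance selection *)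

Section minimum_distance.
Context (dT : measure_display) (T : measurableType dT) (R : realType).
Variable mu : {measure set T -> \bar R}.
Implicit Types f g h p : T -> R.

Lemma measurable_gt_set f g : measurable_fun setT f -> measurable_fun setT g ->
  measurable [set x | g x < f x].
Proof.
move=> mf mg; rewrite (_ : [set x | _] = setT `&` (f \- g) @^-1` `]0, +oo[).
  by apply: measurable_funB => //.
by apply/seteqP; split => x /=; rewrite in_itv/= subr_gt0 andbT; [|case].
Qed.

Lemma integrable_measurable f :
  mu.-integrable setT (EFin \o f) -> measurable_fun setT f.
Proof. by move=> /measurable_int /measurable_EFinP. Qed.

Lemma Rintegral_setCD f (A : set T) : measurable A ->
  mu.-integrable setT (EFin \o f) ->
  \int[mu]_x f x = \int[mu]_(x in A) f x + \int[mu]_(x in ~` A) f x.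
Proof.
move=> mA intf; rewrite -[in LHS](setUv A) Rintegral_setU// ?setUv//.
  exact: measurableC.
by rewrite disj_set2E setICr.
Qed.

Let integrableB_EFin f g : mu.-integrable setT (EFin \o f) ->
  mu.-integrable setT (EFin \o g) -> mu.-integrable setT (EFin \o (f \- g)).
Proof. by move=> intf intg; exact: (integrableB measurableT intf intg). Qed.

Let RintegralB_on (A : set T) f g : measurable A ->
  mu.-integrable setT (EFin \o f) -> mu.-integrable setT (EFin \o g) ->
  \int[mu]_(x in A) (f \- g) x = \int[mu]_(x in A) f x - \int[mu]_(x in A) g x.
Proof.
by move=> mA intf intg; rewrite RintegralB//; apply: integrableS measurableT mA _ _.
Qed.

(** Since [f - g] has integral zero, its positive and negative parts have the same mass, and the
    positive part lives on the set where [g < f]. *)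
Lemma scheffe f g : mu.-integrable setT (EFin \o f) ->
  mu.-integrable setT (EFin \o g) -> \int[mu]_x f x = \int[mu]_x g x ->
  \int[mu]_x `|f x - g x| = 2 * (\int[mu]_(x in [set x | g x < f x]) f x -
                                 \int[mu]_(x in [set x | g x < f x]) g x).
Proof.
move=> intf intg fg; set A := [set x | _].
have mA : measurable A by apply: measurable_gt_set; exact: integrable_measurable.
have inth := integrableB_EFin intf intg.
have h0 := Rintegral_setCD mA inth.
rewrite RintegralB_on// fg subrr in h0.
have inta : mu.-integrable setT (EFin \o (fun x => `|f x - g x|)).
  exact: (integrable_abse inth).
rewrite (Rintegral_setCD mA inta) -RintegralB_on//.
rewrite (@eq_Rintegral _ _ _ _ A (f \- g)); last first.
  by move=> x /set_mem xA; rewrite /= gtr0_norm// subr_gt0.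
rewrite (@eq_Rintegral _ _ _ _ (~` A) (fun x => -1 * (f \- g) x)); last first.
  move=> x /set_mem /negP; rewrite -leNgt => xA /=.
  by rewrite mulN1r ler0_norm// subr_le0.
rewrite RintegralZl; [|exact: measurableC|].
  by lra.
by apply: integrableS measurableT _ _ inth => //; exact: measurableC.
Qed.

(** The integrals of [f - g] over [A] and over its complement are opposite, so twice the left side
    is bounded by the integral of [|f - g|] over the two pieces together. *)
Lemma Rintegral_dist_le_half f g (A : set T) : measurable A ->
  mu.-integrable setT (EFin \o f) -> mu.-integrable setT (EFin \o g) ->
  \int[mu]_x f x = \int[mu]_x g x ->
  `|\int[mu]_(x in A) f x - \int[mu]_(x in A) g x| <=
    2^-1 * \int[mu]_x `|f x - g x|.
Proof.
move=> mA intf intg fg.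
have inth := integrableB_EFin intf intg.
have mCA := measurableC mA.
have inta : mu.-integrable setT (EFin \o (fun x => `|f x - g x|)).
  exact: (integrable_abse inth).
have on B : measurable B -> mu.-integrable B (EFin \o (f \- g)).
  by move=> mB; apply: integrableS measurableT mB _ inth.
have h0 := Rintegral_setCD mA inth.
rewrite RintegralB_on// fg subrr in h0.
rewrite (Rintegral_setCD mA inta) -RintegralB_on//.
have := le_normr_Rintegral mA (on _ mA).
have := le_normr_Rintegral mCA (on _ mCA).
rewrite (_ : \int[mu]_(t in ~` A) (f \- g) t = - \int[mu]_(t in A) (f \- g) t).
  by rewrite normrN /=; lra.
by lra.
Qed.

Lemma Rintegral_dist_triangle f g h : mu.-integrable setT (EFin \o f) ->
  mu.-integrable setT (EFin \o g) -> mu.-integrable setT (EFin \o h) ->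
  \int[mu]_x `|f x - h x| <=
    \int[mu]_x `|f x - g x| + \int[mu]_x `|g x - h x|.
Proof.
move=> intf intg inth.
have I u v : mu.-integrable setT (EFin \o u) -> mu.-integrable setT (EFin \o v) ->
    mu.-integrable setT (EFin \o (fun x => `|u x - v x|)).
  by move=> intu intv; exact: (integrable_abse (integrableB_EFin intu intv)).
rewrite -RintegralD//; try exact: I.
apply: le_Rintegral => //; first exact: I.
  exact: (integrableD measurableT (I _ _ intf intg) (I _ _ intg inth)).
by move=> x _; rewrite -[leLHS]/`|f x - h x| -(subrKA (g x)) ler_normD.
Qed.

Section selection.
Variables (I : finType) (i0 : I) (g : I -> T -> R).
Hypothesis integrable_g : forall i, mu.-integrable setT (EFin \o g i).
Hypothesis integral_g : forall i, \int[mu]_x g i x = 1.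

Definition yatracos (ij : I * I) : set T := [set x | g ij.2 x < g ij.1 x].

Lemma measurable_yatracos ij : measurable (yatracos ij).
Proof. by apply: measurable_gt_set; exact: integrable_measurable. Qed.

(** The data enter only through the table [m], so the selected index is a function of finitely many
    empirical frequencies, as [measurable_empirical_event] requires. The terms are nonnegative, so
    the base value 0 does not alter the maximum. *)
Definition discrepancy (m : I * I -> R) (i : I) : R :=
  \big[Num.max/0]_ij `|\int[mu]_(x in yatracos ij) g i x - m ij|.

Definition minimum_distance (m : I * I -> R) : I :=
  [arg min_(i < i0) discrepancy m i]%O.

(** A deterministic inequality. The selected [s] is compared with the competitor [j]: its distance
    to [g j] is at most 4 times the discrepancy of [j], hence at most twice the distance from [g j]
    to [p] plus [4 * t]. The triangle inequality through [g j] raises the factor 2 to 3. *)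
Lemma minimum_distance_L1 p (m : I * I -> R) (t : R) (j : I) :
  mu.-integrable setT (EFin \o p) -> \int[mu]_x p x = 1 -> 0 <= t ->
  (forall ij, `|m ij - \int[mu]_(x in yatracos ij) p x| <= t) ->
  \int[mu]_x `|g (minimum_distance m) x - p x| <=
    3 * \int[mu]_x `|g j x - p x| + 4 * t.
Proof.
move=> intp p1 t0 mt; set s := minimum_distance m.
have sj : discrepancy m s <= discrepancy m j.
  by rewrite /s /minimum_distance; case: arg_minP => // i _; exact.
have jt : discrepancy m j <= 2^-1 * \int[mu]_x `|g j x - p x| + t.
  have jp0 : 0 <= \int[mu]_x `|g j x - p x| by exact: Rintegral_ge0.
  apply: bigmax_le => [|ij _]; first by lra.
  rewrite -(subrKA (\int[mu]_(x in yatracos ij) p x)).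
  apply: le_trans (ler_normD _ _) _; apply: lerD; last by rewrite distrC.
  apply: Rintegral_dist_le_half => //; first exact: measurable_yatracos.
  by rewrite integral_g p1.
(* By Scheffe's identity the distance is twice a gap of masses on [yatracos (s, j)]. Through
   [m (s, j)] this gap is at most the sum of the two discrepancies, and that of [s] is the smaller
   one. *)
have sgj : \int[mu]_x `|g s x - g j x| <= 4 * discrepancy m j.
  rewrite scheffe// ?integral_g// -/(yatracos (s, j)).
  have bnd i : `|\int[mu]_(x in yatracos (s, j)) g i x - m (s, j)| <= discrepancy m i.
    by rewrite /discrepancy; exact: le_bigmax.
  have := bnd s; have := bnd j; rewrite !ler_norml => /andP[? ?] /andP[? ?].
  by lra.
by have := Rintegral_dist_triangle (integrable_g s) (integrable_g j) intp; lra.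
Qed.

End selection.
End minimum_distance.

(** * Multi-view histograms and their rounding *)

Section simplex_rounding.
Variable R : realType.

(* The zero vector is sent to the first vertex, so that every [m] yields a point
   of the simplex. *)
Definition proportions (n N : nat) (m : {ffun 'I_n -> 'I_N}) (i : 'I_n) : R :=
  if (\sum_j m j == 0)%N then (i == 0 :> nat)%:R
  else (m i)%:R / (\sum_j m j)%:R.

Lemma simplex_proportions (n N : nat) (m : {ffun 'I_n -> 'I_N}) :
  (0 < n)%N -> simplex n (proportions m).
Proof.
move=> n0; rewrite /proportions.
case: (boolP (\sum_j m j == 0)%N) => [_|S0].
  split=> [i|]; first exact: ler0n.
  rewrite (bigD1 (Ordinal n0))//= big1 ?addr0// => i.
  by move=> /eqP i0; case: eqP => // i00; case: i0; exact: val_inj.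
split=> [i|]; first by rewrite divr_ge0.
by rewrite -mulr_suml -natr_sum mulfV// pnatr_eq0.
Qed.

(** Each [N * c i] is replaced by an integer above it, at most 1 away. The sum [S] of these integers
    then lies between [N] and [N + n]. Dividing by [N] costs at most [n / N] in total, and dividing
    by [S] instead costs a further [S / N - 1 <= n / N]. *)
Lemma simplex_rounding (n N : nat) (c : 'I_n -> R) : (0 < N)%N ->
  simplex n c -> exists m : {ffun 'I_n -> 'I_N.+2},
    \sum_i `|c i - proportions m i| <= 2 * n%:R / N%:R.
Proof.
move=> N0 [c0 c1].
have N0R : 0 < N%:R :> R by rewrite ltr0n.
have cle1 i : c i <= 1 by rewrite -c1 (bigD1 i)//= lerDl sumr_ge0.
have tr i : (Num.truncn (N%:R * c i))%:R <= N%:R * c i.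
  by rewrite truncn_le mulr_ge0// ltW.
(* The successor of the truncation is at most [N + 1], hence the range ['I_N.+2]. Rounding up rather
   than down makes [S] positive, so [proportions] never takes its default branch. *)
have lb i : ((Num.truncn (N%:R * c i)).+1 < N.+2)%N.
  rewrite !ltnS -(ler_nat R) (le_trans (tr i))//.
  by rewrite ler_piMr// ltW.
pose m := [ffun i => Ordinal (lb i)]; exists m.
have mlb i : N%:R * c i <= (m i)%:R by rewrite ffunE/= ltW// truncnS_gt.
have mub i : (m i)%:R <= N%:R * c i + 1.
  by rewrite ffunE/= -natr1 lerD2r.
pose S := (\sum_j m j)%N.
have SE : S%:R = \sum_j (m j)%:R :> R by rewrite natr_sum.
have NE : \sum_i N%:R * c i = N%:R by rewrite -mulr_sumr c1 mulr1.
have NS : N%:R <= S%:R :> R.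
  by rewrite SE -NE; apply: ler_sum => i _; exact: mlb.
have SN : S%:R <= N%:R + n%:R :> R.
  rewrite SE -NE -[X in _ + X%:R]card_ord -sumr_const -big_split/=.
  by apply: ler_sum => i _; exact: mub.
have S0 : 0 < S%:R :> R by exact: lt_le_trans NS.
have pE i : proportions m i = (m i)%:R / S%:R.
  by rewrite /proportions -/S -(pnatr_eq0 R) gt_eqF.
have bnd i : `|c i - proportions m i| <= N%:R^-1 + (N%:R^-1 - S%:R^-1) * (m i)%:R.
  rewrite pE -(subrKA ((m i)%:R / N%:R)); apply: le_trans (ler_normD _ _) _.
  apply: lerD.
    have cN : c i = (N%:R * c i) / N%:R by rewrite mulrC mulKf ?gt_eqF.
    rewrite cN -mulrBl normrM (ger0_norm (_ : 0 <= N%:R^-1)) ?invr_ge0//.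
    rewrite ler_piMl ?invr_ge0// distrC ger0_norm ?subr_ge0//.
    by rewrite lerBlDr addrC.
  rewrite -mulrBr mulrC ger0_norm// mulr_ge0// subr_ge0 lef_pV2 ?posrE//.
apply: le_trans (ler_sum _ (fun i _ => bnd i)) _.
rewrite big_split/= sumr_const card_ord -mulr_sumr -SE.
rewrite mulrBl (mulVf (lt0r_neq0 S0)) -[_ *+ n]mulr_natl
  [X in _ <= X](_ : _ = n%:R / N%:R + n%:R / N%:R); last by ring.
rewrite lerD2l lerBlDr mulrC ler_pdivrMr// mulrDl mulfVK ?gt_eqF//; lra.
Qed.

End simplex_rounding.

(** * Distance between products of probability vectors *)

Section product_weights.
Variable R : realType.

(** Telescoping: the factors are exchanged one at a time, and the [j]-th term keeps [a] before [j]
    and [a'] after it. *)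
Lemma prod_dist_le (a a' : nat -> R) n :
  (forall i, 0 <= a i) -> (forall i, 0 <= a' i) ->
  `|\prod_(i < n) a i - \prod_(i < n) a' i| <=
    \sum_(j < n) \prod_(i < n)
      (if (i < j)%N then a i else if i == j :> nat then `|a i - a' i| else a' i).
Proof.
move=> a0 a'0; elim: n => [|n IHn]; first by rewrite !big_ord0 subrr normr0.
rewrite !big_ord_recr/= ltnn eqxx -(subrKA (\prod_(i < n) a i * a' n)).
apply: le_trans (ler_normD _ _) _; rewrite [leLHS]addrC; apply: lerD.
  rewrite -mulrBl normrM (ger0_norm (a'0 n)).
  apply: le_trans (ler_wpM2r (a'0 n) IHn) _; rewrite mulr_suml.
  apply: ler_sum => j _; rewrite big_ord_recr/= ltnNge ltnW//= gt_eqF//.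
  exact: ltn_ord.
rewrite -mulrBr normrM ger0_norm ?prodr_ge0// ler_wpM2r//.
by apply: ler_prod => i _; rewrite ltn_ord a0 lexx.
Qed.

(** In each telescoped term the sum over [m] factorizes over the coordinates, and every factor
    except the [j0]-th sums to one. *)
Lemma sum_prod_dist_le (d b : nat) (c c' : 'I_d -> 'I_b -> R) :
  (forall j, simplex b (c j)) -> (forall j, simplex b (c' j)) ->
  \sum_(m : {ffun 'I_d -> 'I_b}) `|\prod_j c j (m j) - \prod_j c' j (m j)| <=
    \sum_j \sum_l `|c j l - c' j l|.
Proof.
move=> sc sc'.
pose F (j0 j : 'I_d) (l : 'I_b) := if (j < j0)%N then c j l else
  if j == j0 then `|c j l - c' j l| else c' j l.
apply: (@le_trans _ _
  (\sum_(m : {ffun 'I_d -> 'I_b}) \sum_j0 \prod_j F j0 j (m j))).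
  apply: ler_sum => m _.
  (* [prod_dist_le] takes sequences indexed by [nat]; the value 0 beyond [d] only preserves
     nonnegativity. *)
  pose ext (e : 'I_d -> 'I_b -> R) (i : nat) :=
    if insub i is Some j then e j (m j) else 0.
  have extE e (j : 'I_d) : ext e j = e j (m j) by rewrite /ext valK.
  have ext0 e i : (forall j, simplex b (e j)) -> 0 <= ext e i.
    by move=> se; rewrite /ext; case: insubP => // j _ _; exact: (se j).1.
  have := @prod_dist_le (ext c) (ext c') d
    (fun i => ext0 c i sc) (fun i => ext0 c' i sc').
  rewrite (eq_bigr _ (fun j _ => extE c j)) (eq_bigr _ (fun j _ => extE c' j)).
  move=> /le_trans; apply; apply: ler_sum => j0 _.
  rewrite le_eqVlt; apply/orP; left; apply/eqP; apply: eq_bigr => j _.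
  by rewrite /F !extE.
rewrite exchange_big/=; apply: ler_sum => j0 _.
rewrite -bigA_distr_bigA (bigD1 j0)//= [X in _ * X]big1 ?mulr1.
  by apply: ler_sum => l _; rewrite /F ltnn eqxx.
move=> j jj0; rewrite /F (negbTE jj0); case: (j < j0)%N.
  exact: (sc j).2.
exact: (sc' j).2.
Qed.

End product_weights.

(** * Mixtures of finitely many densities *)

Section mixtures.
Context (dT : measure_display) (T : measurableType dT) (R : realType).
Variable mu : {measure set T -> \bar R}.
Variables (J : finType) (u : J -> T -> R).
Hypothesis measurable_u : forall j, measurable_fun setT (u j).
Hypothesis u_ge0 : forall j x, 0 <= u j x.
Hypothesis integral_u : forall j, (\int[mu]_x (u j x)%:E = 1)%E.

Let measurable_mixture (a : J -> R) :
  measurable_fun setT (fun x => \sum_j a j * u j x).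
Proof. by apply: measurable_sum => j; exact: measurable_funM. Qed.

Lemma integral_mixture (a : J -> R) : (forall j, 0 <= a j) ->
  (\int[mu]_x (\sum_j a j * u j x)%:E = (\sum_j a j)%:E)%E.
Proof.
move=> a0; under eq_integral do rewrite -sumEFin.
rewrite ge0_integral_sum//; last 2 first.
- by move=> j; apply/measurable_EFinP; exact: measurable_funM.
- by move=> j x _; rewrite lee_fin mulr_ge0.
rewrite -sumEFin; apply: eq_bigr => j _; under eq_integral do rewrite EFinM.
rewrite ge0_integralZl ?lee_fin ?integral_u ?mule1//.
- exact/measurable_EFinP.
- by move=> x _; rewrite lee_fin.
Qed.

Lemma integrable_mixture (a : J -> R) : (forall j, 0 <= a j) ->
  mu.-integrable setT (EFin \o (fun x => \sum_j a j * u j x)).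
Proof.
move=> a0; apply/integrableP; split; first exact/measurable_EFinP.
under eq_integral => x _.
  rewrite /= ger0_norm; last by apply: sumr_ge0 => j _; rewrite mulr_ge0.
  over.
by rewrite integral_mixture// ltry.
Qed.

(** The pointwise triangle inequality bounds the integrand by the mixture with weights
    [|a j - a' j|], whose integral is their sum. *)
Lemma mixture_dist_le (a a' : J -> R) :
  (\int[mu]_x (`|(\sum_j a j * u j x) - \sum_j a' j * u j x|)%:E <=
    (\sum_j `|a j - a' j|)%:E)%E.
Proof.
rewrite -(@integral_mixture (fun j => `|a j - a' j|))//.
apply: ge0_le_integral => //.
- apply/measurable_EFinP; apply: measurableT_comp => //.
  by apply: measurable_funB.
- exact/measurable_EFinP.
- move=> x _; rewrite lee_fin -sumrB; apply: le_trans (ler_norm_sum _ _ _) _.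
  by apply: ler_sum => j _; rewrite -mulrBl normrM (ger0_norm (u_ge0 j x)).
Qed.

End mixtures.

(** * Multi-view histograms as mixtures of cell densities, and their finite grid *)

Section histograms.
Variables (R : realType) (d b k : nat).
Hypotheses (b_gt0 : (0 < b)%N) (k_gt0 : (0 < k)%N).
Implicit Types (w : 'I_k -> R) (c : 'I_k -> 'I_d -> 'I_b -> R).

Definition histogram w c (x : Rspace R d) : R :=
  \sum_i w i * \prod_j \sum_l c i j l * bin_density l (tnth x j).

Definition atom (m : {ffun 'I_d -> 'I_b}) (x : Rspace R d) : R :=
  \prod_j bin_density (m j) (tnth x j).

Lemma bin_density_ge0 (l : 'I_b) (x : R) : 0 <= bin_density l x.
Proof. by rewrite mulr_ge0. Qed.

Lemma measurable_bin_density (l : 'I_b) :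
  measurable_fun setT (bin_density l : measurableTypeR R -> R).
Proof.
by apply: measurable_funM => //; apply: measurable_indic; exact: measurable_itv.
Qed.

Lemma integral_bin_density (l : 'I_b) :
  (\int[lebesgue_measure]_x (bin_density l x : R)%:E = 1)%E.
Proof.
have b0 : 0 < b%:R :> R by rewrite ltr0n.
under eq_integral do rewrite EFinM.
rewrite ge0_integralZl ?lee_fin//.
- rewrite integral_indic//= setIT lebesgue_measure_itv/= lte_fin.
  rewrite ltr_pM2r ?invr_gt0// ltr_nat ltnSn -EFinB -mulrBl -natrB// subSnn mul1r.
  by rewrite -EFinM mulfV// gt_eqF.
- apply/measurable_EFinP; apply: measurable_indic; exact: measurable_itv.
Qed.

Lemma atom_ge0 m x : 0 <= atom m x.
Proof. by apply: prodr_ge0 => j _; exact: bin_density_ge0. Qed.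

Lemma measurable_atom m : measurable_fun setT (atom m).
Proof.
apply: measurable_prod => j _.
exact: (measurableT_comp (measurable_bin_density (m j)) (measurable_tnth j)).
Qed.

Lemma integral_atom m : (\int[lebesgue R d]_x (atom m x)%:E = 1)%E.
Proof.
apply: etrans (@integral_power_measure_prod _ (measurableTypeR R) R
  lebesgue_measure d (fun j => bin_density (m j)) _ _) _.
- by move=> j; exact: measurable_bin_density.
- by move=> j x; exact: bin_density_ge0.
- by rewrite big1// => j _; exact: integral_bin_density.
Qed.

Let weight w c (im : 'I_k * {ffun 'I_d -> 'I_b}) : R :=
  w im.1 * \prod_j c im.1 j (im.2 j).

(** Multiplying out gives a mixture of uniform densities on cells. Indexing it by pairs keeps the
    [k] components apart, although they share the same atoms, so weights can be compared component
    by component. *)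
Lemma histogramE w c x :
  histogram w c x = \sum_im weight w c im * atom im.2 x.
Proof.
rewrite /histogram -(pair_bigA _ (fun i m => weight w c (i, m) * atom m x))/=.
apply: eq_bigr => i _; rewrite bigA_distr_bigA mulr_sumr.
by apply: eq_bigr => m _; rewrite big_split/= mulrA.
Qed.

Let weight_ge0 w c : simplex k w -> (forall i j, simplex b (c i j)) ->
  forall im, 0 <= weight w c im.
Proof.
move=> [w0 _] sc im; apply: mulr_ge0 => //; apply: prodr_ge0 => j _.
exact: (sc _ _).1.
Qed.

Let sum_prod_simplex (c : 'I_d -> 'I_b -> R) : (forall j, simplex b (c j)) ->
  \sum_(m : {ffun 'I_d -> 'I_b}) \prod_j c j (m j) = 1.
Proof.
by move=> sc; rewrite -bigA_distr_bigA big1// => j _; exact: (sc j).2.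
Qed.

Let sum_weight w c : simplex k w -> (forall i j, simplex b (c i j)) ->
  \sum_im weight w c im = 1.
Proof.
move=> [_ w1] sc; rewrite -(pair_bigA _ (fun i m => weight w c (i, m)))/= -w1.
by apply: eq_bigr => i _; rewrite /weight/= -mulr_sumr sum_prod_simplex ?mulr1.
Qed.

Lemma integrable_histogram w c :
  simplex k w -> (forall i j, simplex b (c i j)) ->
  (lebesgue R d).-integrable setT (EFin \o histogram w c).
Proof.
move=> sw sc; rewrite (funext (histogramE w c)).
apply: (integrable_mixture (u := fun im : 'I_k * _ => atom im.2)).
- by move=> im; exact: measurable_atom.
- by move=> im x; exact: atom_ge0.
- by move=> im; exact: integral_atom.
- exact: weight_ge0.
Qed.

Lemma Rintegral_histogram w c :
  simplex k w -> (forall i j, simplex b (c i j)) ->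
  \int[lebesgue R d]_x histogram w c x = 1.
Proof.
move=> sw sc; rewrite (funext (histogramE w c)) /Rintegral.
rewrite (integral_mixture (u := fun im : 'I_k * _ => atom im.2)).
- by rewrite sum_weight.
- by move=> im; exact: measurable_atom.
- by move=> im x; exact: atom_ge0.
- by move=> im; exact: integral_atom.
- exact: weight_ge0.
Qed.

(** By [mixture_dist_le] it suffices to compare weights. Changing [w] first, with [c] fixed, costs
    [dw]; changing [c] next costs [d * dc] in each component, averaged with the weights [w']. *)
Lemma histogram_dist_le w c w' c' (dw dc : R) :
  simplex k w -> (forall i j, simplex b (c i j)) ->
  simplex k w' -> (forall i j, simplex b (c' i j)) ->
  \sum_i `|w i - w' i| <= dw ->
  (forall i j, \sum_l `|c i j l - c' i j l| <= dc) ->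
  (L1dist (histogram w c) (histogram w' c') <= (dw + d%:R * dc)%:E)%E.
Proof.
move=> sw sc sw' sc' hw hc; rewrite L1distE.
rewrite (funext (histogramE w c)) (funext (histogramE w' c')).
apply: (le_trans (mixture_dist_le
  (u := fun im : 'I_k * _ => atom im.2) _ _ _ _ _)).
- by move=> im; exact: measurable_atom.
- by move=> im x; exact: atom_ge0.
- by move=> im; exact: integral_atom.
rewrite lee_fin -(pair_bigA _
  (fun i m => `|weight w c (i, m) - weight w' c' (i, m)|))/=.
apply: (@le_trans _ _ (\sum_i (`|w i - w' i| + w' i * (d%:R * dc)))); last first.
  by rewrite big_split/= -mulr_suml sw'.2 mul1r lerD2r.
apply: ler_sum => i _; rewrite /weight/=.
have w'0 : 0 <= w' i by exact: sw'.1.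
apply: (@le_trans _ _ (\sum_(m : {ffun 'I_d -> 'I_b})
    (`|w i - w' i| * \prod_j c i j (m j) +
     w' i * `|\prod_j c i j (m j) - \prod_j c' i j (m j)|))).
  apply: ler_sum => m _; rewrite -(subrKA (w' i * \prod_j c i j (m j))).
  apply: le_trans (ler_normD _ _) _; rewrite -mulrBl -mulrBr !normrM.
  rewrite (ger0_norm w'0) (ger0_norm (_ : 0 <= \prod_j c i j (m j)))//.
  by apply: prodr_ge0 => j _; exact: (sc _ _).1.
rewrite big_split/= -!mulr_sumr sum_prod_simplex// mulr1 lerD2l ler_wpM2l//.
apply: le_trans (sum_prod_dist_le (sc i) (sc' i)) _.
rewrite mulr_natl -[X in _ *+ X]card_ord -sumr_const.
by apply: ler_sum => j _; exact: hc.
Qed.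

Lemma multi_view_histogramP q : multi_view_histogram d b k q <->
  exists w c, [/\ simplex k w, forall i j, simplex b (c i j) &
    q = histogram w c].
Proof.
split=> [[w [f [sw hf ->]]]|[w [c [sw sc ->]]]].
  pose c i j := sval (cid2 (hf i j)).
  exists w, c; split => // [i j|]; first by rewrite /c; case: cid2.
  apply/funext => x; apply: eq_bigr => i _; congr (_ * _); apply: eq_bigr => j _.
  by rewrite /c; case: cid2 => /= e _ ->.
exists w, (fun i j x => \sum_l c i j l * bin_density l x); split => // i j.
by exists (c i j).
Qed.

(** Integer vectors, turned into points of simplices by [proportions]. Distinct elements may give
    the same histogram; only an upper bound on the number of candidates matters. *)
Definition grid (K N : nat) : finType :=
  ({ffun 'I_k -> 'I_K.+2} * {ffun 'I_k * 'I_d -> {ffun 'I_b -> 'I_N.+2}})%type.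

Lemma card_grid K N :
  #|grid K N| = (K.+2 ^ k * N.+2 ^ (b * (k * d)))%N.
Proof.
by rewrite card_prod !card_ffun card_prod !card_ord !expnM.
Qed.

Definition grid_histogram K N (z : grid K N) : Rspace R d -> R :=
  histogram (proportions R z.1) (fun i j => proportions R (z.2 (i, j))).

Lemma multi_view_grid_histogram K N (z : grid K N) :
  multi_view_histogram d b k (grid_histogram z).
Proof.
apply/multi_view_histogramP; do 2 eexists; split; last by reflexivity.
  exact: simplex_proportions.
by move=> i j; exact: simplex_proportions.
Qed.

Lemma grid_cover K N q : (0 < K)%N -> (0 < N)%N ->
  multi_view_histogram d b k q ->
  exists z : grid K N, (L1dist q (grid_histogram z) <=
    (2 * k%:R / K%:R + d%:R * (2 * b%:R / N%:R))%:E)%E.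
Proof.
move=> K0 N0 /multi_view_histogramP[w [c [sw sc ->]]].
have [mw hw] := simplex_rounding K0 sw.
pose mc i j := sval (cid (simplex_rounding N0 (sc i j))).
have hc i j : \sum_l `|c i j l - proportions R (mc i j) l| <= 2 * b%:R / N%:R.
  by rewrite /mc; case: cid.
exists (mw, [ffun ij => mc ij.1 ij.2]).
apply: histogram_dist_le => //=.
- exact: simplex_proportions.
- by move=> i j; exact: simplex_proportions.
- by move=> i j; rewrite ffunE; exact: hc.
Qed.

End histograms.

(** * The estimator *)

Section estimator.
Variables (R : realType) (d b k K N : nat).
Hypotheses (b_gt0 : (0 < b)%N) (k_gt0 : (0 < k)%N).
Hypotheses (K_gt0 : (0 < K)%N) (N_gt0 : (0 < N)%N).

Let g : grid d b k K N -> Rspace R d -> R := @grid_histogram R d b k K N.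
Let mu := lebesgue R d.

Let z0 : grid d b k K N := ([ffun=> ord0], [ffun=> [ffun=> ord0]]).

Definition estimator (n : nat) (s : n.-tuple (Rspace R d)) : Rspace R d -> R :=
  g (minimum_distance mu z0 g (fun ij => empirical (yatracos g ij) s)).

Let integrable_g z : mu.-integrable setT (EFin \o g z).
Proof.
apply: integrable_histogram => //; first exact: simplex_proportions.
by move=> i j; exact: simplex_proportions.
Qed.

Let Rintegral_g z : \int[mu]_x g z x = 1.
Proof.
apply: Rintegral_histogram => //; first exact: simplex_proportions.
by move=> i j; exact: simplex_proportions.
Qed.

Let measurable_estimator_event n (Y : set (Rspace R d -> R)) :
  measurable [set s : n.-tuple (Rspace R d) | Y (estimator s)].
Proof.
exact: (@measurable_empirical_event _ _ R n _ (yatracos g)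
  (measurable_yatracos integrable_g)
  [set m | Y (g (minimum_distance mu z0 g m))]).
Qed.

Lemma measurable_sample_space n :
  measurable (sample_space d n : set (n.-tuple (Rspace R d))).
Proof.
rewrite (_ : sample_space d n = \bigcap_(i in [set: 'I_n])
    ((fun s : n.-tuple (Rspace R d) => tnth s i) @^-1` unit_cube d)).
  apply: fin_bigcap_measurable => // i _; rewrite -[X in measurable X]setTI.
  by apply: measurable_tnth => //; exact: measurable_unit_cube.
by apply/seteqP; split => [s sP i _|s sP i]; exact: sP.
Qed.

Lemma is_estimator_estimator n : is_estimator b k (@estimator n).
Proof.
split=> [s _|U _]; first exact: multi_view_grid_histogram.
apply: measurableI; first exact: measurable_sample_space.
exact: measurable_estimator_event.
Qed.

Lemma L1dist_Rintegral (f h : Rspace R d -> R) :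
  mu.-integrable setT (EFin \o f) -> mu.-integrable setT (EFin \o h) ->
  L1dist f h = (\int[mu]_x `|f x - h x|)%:E.
Proof.
move=> intf inth; rewrite L1distE /Rintegral fineK//.
exact: integrable_fin_num (integrable_abse (integrableB measurableT intf inth)).
Qed.

Lemma integrable_pdf (p : density R d) : mu.-integrable setT (EFin \o p).
Proof.
apply/integrableP; split; first by apply/measurable_EFinP; exact: measurable_pdf.
under eq_integral do rewrite /= ger0_norm ?pdf_ge0//.
by rewrite integral_pdf ltry.
Qed.

(** If every Yatracos set has deviation below [t], then [minimum_distance_L1], applied to a grid
    point near a best histogram, bounds the error by 3 times the minimum plus [3 * eta + 4 * t]. A
    large error thus forces a deviation of at least [t], which the union bound over pairs of grid
    points controls. *)
Lemma estimator_deviation n (p : density R d) (eps t : R) :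
  (0 < n)%N -> 0 <= t <= 2 ->
  3 * (2 * k%:R / K%:R + d%:R * (2 * b%:R / N%:R)) + 4 * t <= eps ->
  (iid_law p n [set s | sample_space d n s /\
     3%:E * min_L1dist b k p + eps%:E < L1dist (estimator s) p]
   <= (2 * (#|grid d b k K N| ^ 2)%:R * expR (- (n%:R * t ^+ 2 / 8)))%:E)%E.
Proof.
move=> n0 t02 teps; set eta := 2 * k%:R / K%:R + _ in teps.
have /andP[t0 _] := t02.
have mA := measurable_yatracos integrable_g.
apply: (@le_trans _ _ (iid_law p n [set s | exists ij,
    (t <= `|empirical (yatracos g ij) s -
            fine (density_prob p (yatracos g ij))|)%R])).
  apply: le_measure; rewrite ?inE.
  - by apply: measurableI; [exact: measurable_sample_space|
      exact: (measurable_estimator_event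
        [set f | (3%:E * min_L1dist b k p + eps%:E < L1dist f p)%E])].
  - exact: (@measurable_empirical_event _ _ R n _ (yatracos g) mA [set m | exists ij,
      t <= `|m ij - fine (density_prob p (yatracos g ij))|]).
  move=> s [_ far]; apply: contrapT => /forallNP near; move: far; apply/negP.
  rewrite -leNgt.
  (* A true minimizer leaves the rounding radius [eta] as the only approximation error. *)
  have [q qH ->] := min_L1dist_attained p b_gt0 k_gt0.
  have [z qz] := grid_cover b_gt0 k_gt0 K_gt0 N_gt0 qH.
  have intp := integrable_pdf p.
  have p1 : \int[mu]_x p x = 1 by rewrite /Rintegral integral_pdf.
  have intq : mu.-integrable setT (EFin \o q).
    move: qH => /multi_view_histogramP[w [c [sw sc ->]]].
    exact: integrable_histogram.
  rewrite (L1dist_Rintegral intp intq) (L1dist_Rintegral (integrable_g _) intp).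
  rewrite -EFinM -EFinD lee_fin.
  rewrite (L1dist_Rintegral intq (integrable_g z)) lee_fin -/eta in qz.
  have close ij :
      `|empirical (yatracos g ij) s - \int[mu]_(x in yatracos g ij) p x| <= t.
    by rewrite leNgt; apply/negP => /ltW; exact: near.
  have := minimum_distance_L1 z0 integrable_g Rintegral_g z intp p1 t0 close.
  rewrite -/(estimator s) => /le_trans; apply.
  have := Rintegral_dist_triangle (integrable_g z) intq intp.
  have sym (f h : Rspace R d -> R) :
      \int[mu]_x `|f x - h x| = \int[mu]_x `|h x - f x|.
    by apply: eq_Rintegral => x _; rewrite distrC.
  rewrite (sym (g z) q) (sym q p); lra.
have := empirical_uniform_deviation (density_prob p) n0 mA t02.
by rewrite card_prod mulnn.
Qed.

End estimator.

(** * Size of the grid against the sample size *)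

Definition complexity (R : realType) (b k : nat) : R :=
  b%:R * k%:R * ln b%:R + k%:R * ln k%:R.

Lemma ln_nat_ge0 (R : realType) (n : nat) : 0 <= ln (n%:R : R).
Proof. by case: n => [|n]; [rewrite ln0|rewrite ln_ge0// ler1n]. Qed.

Lemma card_grid_le (R : realType) (d b k : nat) :
  (0 < d)%N -> (1 < b)%N -> (1 < k)%N ->
  #|grid d b k (k ^ 2) (b ^ 2)|%:R <= expR (3 * d%:R * complexity R b k).
Proof.
move=> d0 b1 k1; rewrite card_grid.
(* For [n >= 2], [n ^ 2 + 2 <= 2 * n ^ 2 <= n ^ 3]. The exponent 3 becomes the factor 3 in front of
   the logarithms. *)
have cube n : (1 < n)%N -> ((n ^ 2).+2 <= n ^ 3)%N.
  move=> n1; rewrite expnS; apply: (@leq_trans (2 * n ^ 2)); last by rewrite leq_mul.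
  by rewrite mul2n -addnn -addn2 leq_add2l -mulnn (leq_trans n1)// leq_pmulr// ltnW.
have b0 : 0 < b%:R :> R by rewrite ltr0n ltnW.
have k0 : 0 < k%:R :> R by rewrite ltr0n ltnW.
apply: (@le_trans _ _ ((k ^ 3) ^ k * (b ^ 3) ^ (b * (k * d)))%N%:R).
  have k0N : (0 < k)%N by exact: ltnW.
  have e0N : (0 < b * (k * d))%N by rewrite !muln_gt0 (ltnW b1) k0N d0.
  rewrite ler_nat; apply: leq_mul; first by rewrite (leq_exp2r _ _ k0N) (cube _ k1).
  by rewrite (leq_exp2r _ _ e0N) (cube _ b1).
rewrite -!expnM natrM !natrX -{1}[k%:R](lnK k0) -{1}[b%:R](lnK b0).
rewrite -!expRM_natl -expRD ler_expR !natrM /complexity.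
have d1 : 1 <= d%:R :> R by rewrite ler1n.
have kl : 0 <= k%:R * ln k%:R :> R by rewrite mulr_ge0// ln_nat_ge0.
have := ler_wpM2r kl d1; lra.
Qed.

(** The squared cardinality is at most [expR (6 * d * D)], and the assumed rate makes the tail at
    most [expR (- ((6 * d + 1) * D))]. The remaining [expR (- D)] is at most [1 / k], since
    [D >= k * ln k >= ln k]. *)
Lemma deviation_bound (R : realType) (d b k n : nat) (t : R) :
  (0 < d)%N -> (1 < b)%N -> (1 < k)%N -> 0 < t ->
  8 * (6 * d%:R + 1) / t ^+ 2 <= n%:R / complexity R b k ->
  2 * (#|grid d b k (k ^ 2) (b ^ 2)| ^ 2)%:R * expR (- (n%:R * t ^+ 2 / 8))
    <= 2 / k%:R :> R.
Proof.
move=> d0 b1 k1 t0; set D := complexity R b k => rate.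
have b0 : 0 < b%:R :> R by rewrite ltr0n ltnW.
have k0 : 0 < k%:R :> R by rewrite ltr0n ltnW.
have kl : 0 <= k%:R * ln k%:R :> R by rewrite mulr_ge0// ln_nat_ge0.
have D0 : 0 < D.
  by rewrite /D ltr_wpDr// !mulr_gt0// ln_gt0// ltr1n.
have t20 : 0 < t ^+ 2 by rewrite exprn_gt0.
have nD : (6 * d%:R + 1) * D <= n%:R * t ^+ 2 / 8.
  move: rate; rewrite ler_pdivlMr// mulrAC ler_pdivrMr//; lra.
rewrite -mulrA ler_wpM2l// natrX.
apply: (@le_trans _ _ (expR (3 * d%:R * D) ^+ 2 * expR (- ((6 * d%:R + 1) * D)))).
  apply: ler_pM; [by rewrite exprn_ge0|exact: expR_ge0| |by rewrite ler_expR lerN2].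
  by rewrite lerXn2r ?nnegrE ?expR_ge0// card_grid_le.
rewrite -expRM_natl -expRD (_ : _ + _ = - D); last by ring.
rewrite expRN lef_pV2 ?posrE ?expR_gt0// -{1}(lnK k0) ler_expR /D /complexity.
have : 0 <= b%:R * k%:R * ln b%:R :> R by rewrite !mulr_ge0// ln_nat_ge0.
have : ln k%:R <= k%:R * ln k%:R :> R.
  by rewrite ler_peMl ?ln_nat_ge0// ler1n ltnW.
lra.
Qed.

(** Ensures that the supremum over densities ranges over a nonempty set and is therefore at least
    0. *)
Lemma uniform_density (R : realType) (d : nat) : density R d.
Proof.
have mcube := @measurable_unit_cube R d.
apply: (@Density R d (\1_(unit_cube d))) => [|x|x nx|].
- exact: measurable_indic.
- by [].
- by rewrite indicE memNset.
- by rewrite integral_indic// setIT; exact: lebesgue_unit_cube.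
Qed.

Theorem theorem2p1 (R : realType) (d : nat) (d_ge1 : (1 <= d)%N)
    (b k : nat -> nat)
    (b_gt0 : forall n, (0 < b n)%N) (k_gt0 : forall n, (0 < k n)%N)
    (b_oo : b @ \oo --> \oo) (k_oo : k @ \oo --> \oo)
    (rate : (n%:R / ((b n)%:R * (k n)%:R * ln (b n)%:R
                     + (k n)%:R * ln (k n)%:R) : R) @[n --> \oo] --> +oo) :
  exists2 V : forall n, n.-tuple (Rspace R d) -> Rspace R d -> R,
    forall n, is_estimator (b n) (k n) (V n) &
    forall eps : R, 0 < eps ->
      ereal_sup [set iid_law p n
          [set s | sample_space d n s /\
             (3%:E * min_L1dist (b n) (k n) p + eps%:E < L1dist (V n s) p)%E]
        | p in [set: density R d]] @[n --> \oo] --> 0%E.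
Proof.
exists (fun n => @estimator R d (b n) (k n) (k n ^ 2) (b n ^ 2) n).
  by move=> n; exact: is_estimator_estimator.
(* Half of [eps] is spent on [4 * t]; the cap 2 is the range of the tail bound. *)
move=> eps eps0; pose t : R := Num.min (eps / 8) 2.
have t0 : 0 < t by rewrite lt_min divr_gt0// ltr0n.
have t8 : t <= eps / 8 by rewrite /t ge_min lexx.
have t2 : t <= 2 by rewrite /t ge_min lexx orbT.
have natR_oo (f : nat -> nat) : f @ \oo --> \oo ->
    forall A : R, \forall n \near \oo, A <= (f n)%:R.
  by move=> f_oo; apply/cvgryPge/cvgrnyP.
have bound0 : ((2 / (k n)%:R : R)%:E) @[n --> \oo] --> 0%E.
  apply: cvg_EFin; first by apply: nearW.
  rewrite -[X in _ --> X](mulr0 (2 : R)); apply: cvgM; first exact: cvg_cst.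
  apply/gtr0_cvgV0; first by apply: nearW => n; rewrite ltr0n.
  by apply/cvgryPge; exact: natR_oo.
(* The upper bound [2 / k n] is the same for all densities, so it also bounds the supremum. *)
apply: (squeeze_cvge _ (cvg_cst 0%E) bound0).
near=> n.
have b1 : (1 < b n)%N by near: n; move/cvgnyPge : b_oo; exact.
have k1 : (1 < k n)%N by near: n; move/cvgnyPge : k_oo; exact.
have n0 : (0 < n)%N by near: n; exact: nbhs_infty_gt.
(* Once [k n] and [b n] exceed [c], the rounding radius [2 / k + 2 * d / b] is at most [eps / 6];
   three times it is the other half of [eps]. *)
pose c : R := 12 * (1 + d%:R) / eps.
have c0 : 0 < c by rewrite divr_gt0// mulr_gt0// ltr_wpDr.
have kc : c <= (k n)%:R by near: n; exact: natR_oo.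
have bc : c <= (b n)%:R by near: n; exact: natR_oo.
apply/andP; split.
  apply: le_trans (ereal_sup_ubound _); last by exists (uniform_density R d).
  exact: measure_ge0.
apply: ge_ereal_sup => _ [p _ <-].
apply: (le_trans (@estimator_deviation R d (b n) (k n) (k n ^ 2) (b n ^ 2)
  (b_gt0 n) (k_gt0 n) _ _ n p eps t n0 _ _)).
- by rewrite expn_gt0 k_gt0.
- by rewrite expn_gt0 b_gt0.
- by rewrite ltW.
- have inv_le (m : nat) : c <= m%:R -> 2 * m%:R / (m ^ 2)%:R <= 2 / c.
    move=> cm; have m0 : 0 < m%:R :> R by exact: lt_le_trans cm.
    rewrite natrX expr2 invfM mulrA mulfK ?gt_eqF// ler_wpM2l// lef_pV2 ?posrE//.
  have ecE : 2 / c * (1 + d%:R) = eps / 6.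
    by rewrite /c; field; rewrite ?gt_eqF// ltr_wpDr.
  have := inv_le _ kc; have := ler_wpM2l (ler0n R d) (inv_le _ bc); lra.
rewrite lee_fin; apply: deviation_bound => //.
near: n; move/cvgryPge : rate; exact.
Unshelve. all: by end_near.
Qed.
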